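(* Procedure Mis\_SWD, executed from a synchronized start, terminates after $O(\log^8N\log\Delta)$ rounds, and with probability at least $1-(\log\Delta)/n^2$ the set of nodes with status leader at termination is a maximal independent set of the communication graph $G$.
   Context: Model: $n$ nodes in the Euclidean plane with unique names in $\{1,\dots,N\}$, $N\ge n$; synchronous rounds, each node transmits or listens, no collision detection; uniform power $P$, constants $\alpha>2$, $\mathcal{N}>0$, $\beta\ge1$, $\varepsilon\in(0,1)$, $r=(P/(\mathcal{N}\beta))^{1/\alpha}$; if set $\mathcal{T}$ transmits, $u\notin\mathcal{T}$ receives from $v\in\mathcal{T}$ iff $\frac{P\,\mathrm{dist}(v,u)^{-\alpha}}{\mathcal{N}+\sum_{w\in\mathcal{T}\setminus\{v\}}P\,\mathrm{dist}(w,u)^{-\alpha}}\ge\beta$ and $\mathrm{dist}(v,u)\le(1-\varepsilon)r$. Communication graph $G$: $u\sim v$ iff $\mathrm{dist}(u,v)\le(1-\varepsilon)r$; $\Delta$ = maximum degree of $G$ (known to nodes; $\Delta$, $N$ powers of 2). An $(N,x)$-ssf is a family $(S_0,\dots,S_{s-1})$ of subsets of $\{1,\dots,N\}$ such that for every nonempty $Z$ with $|Z|\le x$ and every $z\in Z$ some $S_i\cap Z=\{z\}$; executing it, a participating node $v$ transmits in the $i$-th round iff $v\in S_i$. Synchronized start: all nodes start the execution in the same round. Procedure Mis\_SWD (all nodes start as workers; statuses worker, candidate, leader, slave, with leader and slave final): phases $i=0,1,\dots,\log\Delta$, each consisting of $C\log N$ sub-phases ($C$ a sufficiently large constant). Each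 sub-phase has two stages. Stage 1: each worker independently becomes a candidate with probability $2^i/\Delta$; candidates transmit their names by executing an $(N,c_1\log^3N)$-ssf of length $O(\log^7N)$ ($c_1$ a sufficiently large constant); a candidate that hears a message from another candidate becomes a worker again, otherwise it becomes a leader. Stage 2: the nodes that became leaders in Stage 1 transmit their names executing the same kind of ssf; every worker that hears at least one name becomes a slave, with the leader of smallest name heard as its master.
   Formalization: Assumes Δ ≥ 2 (log Δ ≥ 1), since for Δ = 1 the claim fails: two adjacent nodes are always both candidates, hear each other and never become leaders; nodes are also taken at pairwise distinct positions so that dist^{-α} is defined. *)

(* Defs.v *)
From HB Require Import structures.
From mathcomp Require Import all_boot all_order all_algebra.
From mathcomp Require Import reals exp.
Set Implicit Arguments. Unset Strict Implicit. Unset Printing Implicit Defensive.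
Import Order.TTheory GRing.Theory Num.Theory.
Local Open Scope ring_scope.

Section SINR.
Variable R : realType.
Variable n : nat.
Variable pos : 'I_n -> R * R.
Variables (alpha beta eps P Noise : R).

Definition dist (u v : 'I_n) : R :=
  Num.sqrt (((pos u).1 - (pos v).1) ^+ 2 + ((pos u).2 - (pos v).2) ^+ 2).

Definition range : R := (P / (Noise * beta)) `^ (alpha^-1).

Definition adj (u v : 'I_n) : bool :=
  (u != v) && (dist u v <= (1 - eps) * range).

Definition degree (v : 'I_n) : nat := #|[set u | adj u v]|.

Definition receives (T : {set 'I_n}) (v u : 'I_n) : bool :=
  [&& v \in T, u \notin T, dist v u <= (1 - eps) * range &
      beta <= (P * dist v u `^ (- alpha)) /
              (Noise + \sum_(w in T | w != v) P * dist w u `^ (- alpha))].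

Definition is_mis (S : {set 'I_n}) : bool :=
  [forall u in S, forall v in S, ~~ adj u v] &&
  [forall u, (u \notin S) ==> [exists v in S, adj u v]].

Variable name : 'I_n -> nat.
Variable F : seq (nat -> bool).

Definition ssf_set (j : nat) : nat -> bool := nth (fun _ => false) F j.

Definition tx_set (active : 'I_n -> bool) (j : nat) : {set 'I_n} :=
  [set v | active v && ssf_set j (name v)].

Definition heard (T : {set 'I_n}) (u : 'I_n) : seq nat :=
  [seq name v | v <- enum T & receives T v u].

Definition run_ssf (active : 'I_n -> bool) : ('I_n -> seq nat) * nat :=
  foldl (fun acc j =>
           let T := tx_set active j in
           ((fun u => acc.1 u ++ heard T u), acc.2.+1))
        ((fun _ => [::]), 0%N) (iota 0 (size F)).

Inductive status := Worker | Leader | Slave of nat (* name of the master *).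

Definition is_worker (s : status) : bool := if s is Worker then true else false.
Definition is_leader (s : status) : bool := if s is Leader then true else false.

Definition seq_min (s : seq nat) : nat := foldr minn (head 0%N s) s.

Definition subphase (st : 'I_n -> status) (coin : 'I_n -> bool)
    : ('I_n -> status) * nat :=
  let cand := fun v => is_worker (st v) && coin v in
  let h1 := run_ssf cand in
  let newl := fun v => cand v && (h1.1 v == [::]) in
  let st1 := fun v => if newl v then Leader else st v in
  let h2 := run_ssf newl in
  let st2 := fun v => if is_worker (st1 v) && (h2.1 v != [::])
                      then Slave (seq_min (h2.1 v)) else st1 v in
  (st2, (h1.2 + h2.2)%N).

(* the whole procedure: phases i = 0..d (d = log Delta), each with
   m = C log N sub-phases; omega (i, j, v) = random choice of v in
   sub-phase j of phase i.  Returns final statuses and total rounds. *)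
Definition mis_swd (d m : nat) (omega : {ffun ('I_d.+1 * 'I_m) * 'I_n -> bool})
    : ('I_n -> status) * nat :=
  foldl (fun acc (ij : 'I_d.+1 * 'I_m) =>
           let res := subphase acc.1 (fun v => omega (ij, v)) in
           (res.1, (acc.2 + res.2)%N))
        ((fun _ => Worker), 0%N)
        [seq (i, j) | i <- enum 'I_d.+1, j <- enum 'I_m].

Definition leaders (d m : nat) (omega : {ffun ('I_d.+1 * 'I_m) * 'I_n -> bool})
    : {set 'I_n} :=
  [set v | is_leader ((mis_swd omega).1 v)].

(* probability of the random choices: independently, in phase i each
   choice is "candidate" with probability 2^i / Delta = 2^i / 2^d *)
Definition cand_prob (d : nat) (i : 'I_d.+1) : R :=
  (2 ^ i)%:R / (2 ^ d)%:R.

Definition weight (d m : nat) (omega : {ffun ('I_d.+1 * 'I_m) * 'I_n -> bool}) : R :=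
  \prod_(t : ('I_d.+1 * 'I_m) * 'I_n)
     (if omega t then cand_prob t.1.1 else 1 - cand_prob t.1.1).

Definition prob_mis (d m : nat) : R :=
  \sum_(omega : {ffun ('I_d.+1 * 'I_m) * 'I_n -> bool})
     weight omega * (is_mis (leaders omega))%:R.

End SINR.

Definition is_ssf (N x : nat) (Fm : seq (nat -> bool)) : Prop :=
  (forall i y, (i < size Fm)%N -> nth (fun _ => false) Fm i y -> (0 < y <= N)%N) /\
  (forall Z : seq nat, uniq Z -> all (fun z => 0 < z <= N)%N Z ->
     (0 < size Z <= x)%N ->
     forall z, z \in Z ->
       exists2 i, (i < size Fm)%N &
         forall y, y \in Z -> nth (fun _ => false) Fm i y = (y == z)).

(* Main.v *)
(* Call a sub-phase clear if around no worker u the candidates jam the channel: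
   at most c1 log^3 N of them lie within distance B R0 / 2 of u, where R0 is the
   communication range and B is proportional to log N, and the interference from
   farther away stays below the slack left by the factor 1 - eps.  In phase i every
   worker has at most D = Delta / 2^i worker neighbours and is a candidate with
   probability p = 1 / D, so the expected number of candidates in a disc of area
   A R0^2, A >= 1, is O(A).  As alpha > 2, a dyadic decomposition bounds the expected far
   interference, and exponential moments bound the probability of jamming at u by
   b = 2 exp(- B^2).  In a clear sub-phase the ssf delivers every message between
   neighbours, so that leaders stay independent, slaves dominated, and workers away
   from leaders.

   A worker becomes a leader with probability at least p / 4.  If it has at least
   D / 2 worker neighbours, then with probability at least 1 / 32 one of them is the
   only candidate in its own neighbourhood and in that of the worker, which
   therefore becomes a slave.  A potential summed over the workers then shows that
   after phase i each worker has fewer than D / 2 worker neighbours, except with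
   probability at most n ((31/32)^m + 4 b Delta), m being the number of sub-phases.
   In the last phase the remaining workers are isolated, are candidates with
   probability 1, and all become leaders. *)
Require Import Defs.
From HB Require Import structures.
From mathcomp Require Import all_boot all_order all_algebra.
From mathcomp Require Import reals exp.
From mathcomp Require Import sequences.
From mathcomp Require Import ring lra zify.
Import Order.TTheory GRing.Theory Num.Theory.
Local Open Scope ring_scope.
Set Implicit Arguments. Unset Strict Implicit. Unset Printing Implicit Defensive.

(** * Independent coins *)

Lemma expR_le_1D2 (R : realType) (a : R) :
  0 <= a <= 2^-1 -> expR a <= 1 + 2 * a.
Proof.
move=> /andP[a0 a1].
have h : 1 - a <= expR (- a) by have := expR_ge1Dx (- a).
have e0 := expR_gt0 a.
have : expR a * (1 - a) <= 1.
  by rewrite -[leRHS](expRxMexpNx_1 a) ler_wpM2l // ltW.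
nra.
Qed.

(** The value is [1/4] at exponent [2], and doubling the exponent cannot decrease it, since
    [(1 - x/2)^2 >= 1 - x]. *)
Lemma one_sub_inv_pow2_exp (R : realFieldType) (k : nat) :
  4^-1 <= (1 - (2 ^+ k.+1)^-1) ^+ (2 ^ k.+1) :> R.
Proof.
elim: k => [|k IH]; first by rewrite expr1 expn1 expr2; lra.
rewrite [X in _ ^+ X]expnS exprM; apply: le_trans IH _.
have hp : 0 < (2 ^+ k.+1)^-1 :> R by rewrite invr_gt0 exprn_gt0.
have hp1 : (2 ^+ k.+1)^-1 <= 1 :> R by rewrite invf_le1 ?exprn_gt0 // exprn_ege1 // ler1n.
rewrite [2 ^+ k.+2]exprS invfM.
set x := (2 ^+ k.+1)^-1 in hp hp1 *.
by apply: lerXn2r; rewrite ?nnegrE ?subr_ge0 //; nra.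
Qed.

Section BernoulliProduct.
Variables (R : realType) (I : finType).

Definition bern (p : R) (b : bool) : R := if b then p else 1 - p.

Definition coin_weight (p : R) (c : {ffun I -> bool}) : R :=
  \prod_v bern p (c v).

Definition coin_mean (p : R) (f : {ffun I -> bool} -> R) : R :=
  \sum_c coin_weight p c * f c.

Variable p : R.
Hypothesis p01 : 0 <= p <= 1.

Lemma bern_ge0 b : 0 <= bern p b.
Proof. by have /andP[p0 p1] := p01; rewrite /bern; case: b; lra. Qed.

Lemma coin_weight_ge0 c : 0 <= coin_weight p c.
Proof. by apply: prodr_ge0 => v _; apply: bern_ge0. Qed.

Lemma coin_mean_prod (h : I -> bool -> R) :
  coin_mean p (fun c => \prod_v h v (c v)) =
  \prod_v (p * h v true + (1 - p) * h v false).
Proof.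
rewrite /coin_mean /coin_weight.
transitivity (\sum_(c : {ffun I -> bool}) \prod_v (bern p (c v) * h v (c v))).
  by apply: eq_bigr => c _; rewrite big_split.
rewrite -(bigA_distr_bigA (fun v b => bern p b * h v b)).
by apply: eq_bigr => v _; rewrite big_bool.
Qed.

Lemma coin_mean_cst a : coin_mean p (fun=> a) = a.
Proof.
rewrite /coin_mean -mulr_suml.
transitivity (coin_mean p (fun c => \prod_(v : I) 1) * a).
  by congr (_ * _); apply: eq_bigr => c _; rewrite big1_eq mulr1.
by rewrite (coin_mean_prod (fun _ _ => 1)) big1 ?mul1r // => v _; lra.
Qed.

Lemma ler_coin_mean f g : (forall c, f c <= g c) -> coin_mean p f <= coin_mean p g.
Proof. by move=> h; apply: ler_sum => c _; rewrite ler_wpM2l ?coin_weight_ge0. Qed.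

Lemma eq_coin_mean f g : f =1 g -> coin_mean p f = coin_mean p g.
Proof. by move=> h; apply: eq_bigr => c _; rewrite h. Qed.

Lemma coin_meanD f g :
  coin_mean p (fun c => f c + g c) = coin_mean p f + coin_mean p g.
Proof. by rewrite -big_split; apply: eq_bigr => c _; rewrite mulrDr. Qed.

Lemma coin_meanZ a f : coin_mean p (fun c => a * f c) = a * coin_mean p f.
Proof. by rewrite mulr_sumr; apply: eq_bigr => c _; rewrite mulrCA. Qed.

Lemma coin_mean_sum (J : finType) (A : pred J) (f : J -> {ffun I -> bool} -> R) :
  coin_mean p (fun c => \sum_(j | A j) f j c) = \sum_(j | A j) coin_mean p (f j).
Proof.
rewrite exchange_big; apply: eq_bigr => c _.
by rewrite mulr_sumr.
Qed.

Lemma coin_mean_sole (w : I) (A : {set I}) : w \notin A ->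
  coin_mean p (fun c => (c w && [forall v in A, ~~ c v])%:R) =
  p * (1 - p) ^+ #|A|.
Proof.
move=> wA.
(* The indicator of the event factors over the coins, so its mean is a product of one-coin means. *)
pose h (v : I) (b : bool) : R := if v == w then b%:R else if v \in A then (~~ b)%:R else 1.
have hE c : (c w && [forall v in A, ~~ c v])%:R = \prod_v h v (c v).
  rewrite (bigD1 w) //= {1}/h eqxx.
  case: (c w) => /=; last by rewrite mul0r.
  rewrite mul1r; case: forallP => [hall|hn].
    rewrite big1 // => v vw; rewrite /h (negbTE vw).
    by case: ifP => // vA; have := hall v; rewrite vA /= => ->.
  have /forallPn[v] : ~~ [forall v, (v \in A) ==> ~~ c v] by apply/negP => /forallP.
  rewrite negb_imply negbK => /andP[vA cv].
  have vw : v != w by apply: contraNneq wA => <-.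
  by rewrite (bigD1 v) //= /h (negbTE vw) vA cv mul0r.
rewrite (eq_coin_mean hE) coin_mean_prod (bigD1 w) //= /h eqxx.
rewrite mulr1 mulr0 addr0; congr (_ * _).
rewrite (bigID (fun v => v \in A)) /= [X in _ * X]big1 ?mulr1; last first.
  by move=> v /andP[/negbTE-> /negbTE->]; lra.
rewrite (eq_bigl (fun v => v \in A)); last first.
  by move=> v; case: eqP => [->|] //=; rewrite (negbTE wA).
rewrite -prodr_const; apply: eq_bigr => v vA.
have /negbTE-> : v != w by apply: contraNneq wA => <-.
by rewrite vA mulr0 add0r mulr1.
Qed.

(** Exponential Markov inequality with parameter [1/2]: as [exp (a/2) <= 1 + a] on [[0, 1]], each
    coin contributes at most [1 + p a <= exp (p a)] to the exponential moment. *)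
Lemma coin_chernoff (a : I -> R) (S t : R) :
  (forall v, 0 <= a v <= 1) -> p * \sum_v a v <= S ->
  coin_mean p (fun c => (t < \sum_(v | c v) a v)%R%:R) <= expR (S - t / 2).
Proof.
move=> a01 hS.
have -> : S - t / 2 = - (t / 2) + S by rewrite addrC.
rewrite expRD -lter_pdivrMl ?expR_gt0 // -expRN opprK -coin_meanZ.
apply: (@le_trans _ _ (coin_mean p (fun c => \prod_v (if c v then expR (a v / 2) else 1)))).
  apply: ler_coin_mean => c.
  rewrite -big_mkcond /= -expR_sum -mulr_suml.
  case: ltP => [h|_]; rewrite ?mulr1 ?mulr0 ?expR_ge0 //.
  by rewrite ler_expR; lra.
rewrite (coin_mean_prod (fun v b => if b then expR (a v / 2) else 1)).
apply: (@le_trans _ _ (expR (p * \sum_v a v))); last by rewrite ler_expR.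
rewrite mulr_sumr expR_sum; apply: ler_prod => v _.
have /andP[a0 a1] := a01 v.
have := @expR_le_1D2 R (a v / 2); have := expR_ge1Dx (p * a v).
have := expR_gt0 (a v / 2).
move=> h1 h2 h3; have /andP[p0 p1] := p01.
have {}h3 : expR (a v / 2) <= 1 + 2 * (a v / 2) by apply: h3; lra.
apply/andP; split; first by nra.
nra.
Qed.

End BernoulliProduct.

(** * Joint product law against round-by-round expectation *)

Section SequentialCoins.
Variables (R : realType) (I : finType) (T : finType) (S : Type).
Variable step : S -> {ffun I -> bool} -> S.

(** An iterated conditional expectation: fresh coins are averaged at each step, so that one-step
    bounds valid from every state can be chained by induction. *)
Fixpoint seq_mean (ps : seq R) (g : S -> R) (st : S) : R :=
  if ps is p :: ps' then coin_mean p (fun c => seq_mean ps' g (step st c))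
  else g st.

Lemma seq_mean_cat ps1 ps2 g st :
  seq_mean (ps1 ++ ps2) g st = seq_mean ps1 (seq_mean ps2 g) st.
Proof. by elim: ps1 st => //= p ps1 IH st; apply: eq_coin_mean => c. Qed.

Lemma seq_mean_le1 ps g st : all (fun p => 0 <= p <= 1) ps ->
  (forall st, g st <= 1) -> seq_mean ps g st <= 1.
Proof.
move=> + g1; elim: ps st => [|p ps IH] st //= /andP[p01 hps].
rewrite -[leRHS](@coin_mean_cst R I p 1).
by apply: ler_coin_mean => // c; apply: IH.
Qed.

Variable pr : T -> R.

Definition coins_at (w : {ffun T * I -> bool}) (t : T) : {ffun I -> bool} :=
  [ffun v => w (t, v)].

Definition set_coins (w : {ffun T * I -> bool}) (t : T) (c : {ffun I -> bool}) :
    {ffun T * I -> bool} :=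
  [ffun x => if x.1 == t then c x.2 else w x].

Definition joint_weight (w : {ffun T * I -> bool}) : R :=
  \prod_x bern (pr x.1) (w x).

Lemma joint_weightE w : joint_weight w = \prod_t coin_weight (pr t) (coins_at w t).
Proof.
rewrite /joint_weight /coin_weight.
rewrite (pair_bigA _ (fun t v => bern (pr t) (coins_at w t v))) /=.
by apply: eq_bigr => -[t v] _; rewrite ffunE.
Qed.

Lemma coins_at_set w t c : coins_at (set_coins w t c) t = c.
Proof. by apply/ffunP => v; rewrite !ffunE /= eqxx. Qed.

Lemma coins_at_set_neq w t c t' : t' != t ->
  coins_at (set_coins w t c) t' = coins_at w t'.
Proof. by move=> h; apply/ffunP => v; rewrite !ffunE /= (negbTE h). Qed.

Lemma set_coins_at w t c : set_coins (set_coins w t c) t (coins_at w t) = w.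
Proof.
apply/ffunP => -[t' v]; rewrite !ffunE /=.
by case: eqP => [->|].
Qed.

(* Swapping the coins of time [t] with an independent copy preserves the joint law. *)
Lemma joint_mean_resample (t : T) (f : {ffun T * I -> bool} -> R) :
  \sum_w joint_weight w * f w =
  \sum_w joint_weight w * coin_mean (pr t) (fun c => f (set_coins w t c)).
Proof.
pose W' w := \prod_(t' | t' != t) coin_weight (pr t') (coins_at w t').
have WE w : joint_weight w = coin_weight (pr t) (coins_at w t) * W' w.
  by rewrite joint_weightE (bigD1 t).
have W's w c : W' (set_coins w t c) = W' w.
  by apply: eq_bigr => t' tt'; rewrite coins_at_set_neq.
pose sw (x : {ffun T * I -> bool} * {ffun I -> bool}) :=
  (set_coins x.1 t x.2, coins_at x.1 t).
have swK : involutive sw.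
  by move=> [w c]; rewrite /sw /= set_coins_at coins_at_set.
transitivity (\sum_(x : {ffun T * I -> bool} * {ffun I -> bool}) joint_weight x.1 * (coin_weight (pr t) x.2 * f x.1)).
  rewrite -(pair_bigA _ (fun w (c : {ffun I -> bool}) => joint_weight w * (coin_weight (pr t) c * f w))) /=.
  apply: eq_bigr => w _; rewrite -mulr_sumr; congr (_ * _).
  by rewrite -[LHS](@coin_mean_cst R I (pr t) (f w)).
rewrite (reindex_inj (inv_inj swK)) /=.
transitivity (\sum_(x : {ffun T * I -> bool} * {ffun I -> bool}) joint_weight x.1 * (coin_weight (pr t) x.2 * f (set_coins x.1 t x.2))).
  apply: eq_bigr => -[w c] _ /=.
  by rewrite !WE coins_at_set W's; ring.
rewrite -(pair_bigA _ (fun w (c : {ffun I -> bool}) => joint_weight w * (coin_weight (pr t) c * f (set_coins w t c)))) /=.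
by apply: eq_bigr => w _; rewrite -mulr_sumr.
Qed.

Lemma joint_mean1 : \sum_w joint_weight w = 1.
Proof.
rewrite /joint_weight.
rewrite -(bigA_distr_bigA (fun (x : T * I) b => bern (pr x.1) b)).
by apply: big1 => x _; rewrite big_bool /bern /= subrKC.
Qed.

(** Resampling the coins of the first time separates them from the rest. As times do not repeat, the
    later steps never read the resampled coins, and induction applies. *)
Lemma joint_mean_seq (ts : seq T) (g : S -> R) (st : S) : uniq ts ->
  \sum_w joint_weight w * g (foldl (fun s t => step s (coins_at w t)) st ts) =
  seq_mean (map pr ts) g st.
Proof.
elim: ts st => [|t ts IH] st /=; first by rewrite -mulr_suml joint_mean1 mul1r.
move=> /andP[tts uts].
rewrite (joint_mean_resample t).
under eq_bigr => w _ do rewrite /coin_mean mulr_sumr.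
rewrite exchange_big /=; apply: eq_bigr => c _.
rewrite -IH // mulr_sumr; apply: eq_bigr => w _.
rewrite coins_at_set mulrCA; congr (_ * (_ * g _)).
have : all (fun t' => t' != t) ts.
  by apply/allP => t' h; apply: contraNneq tts => <-.
elim: {IH tts uts} ts (step st c) => //= t' ts IH s /andP[h1 h2].
by rewrite coins_at_set_neq // IH.
Qed.

End SequentialCoins.

(** * Sub-phases preserve the invariants *)

Section Subphase.
Variables (R : realType) (n : nat) (pos : 'I_n -> R * R).
Variables (alpha beta eps P Noise : R) (name : 'I_n -> nat).
Variable F : seq (nat -> bool).

Local Notation rcv := (receives pos alpha beta eps P Noise).
Local Notation adjacent := (adj pos alpha beta eps P Noise).
Local Notation ssf_run := (run_ssf pos alpha beta eps P Noise name F).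
Local Notation hears act u := ((ssf_run act).1 u != [::]).
Local Notation next st c := (subphase pos alpha beta eps P Noise name F st c).1.

Lemma distC u v : dist pos u v = dist pos v u.
Proof. by rewrite /dist -[X in X + _]sqrrN -[X in _ + X]sqrrN !opprB. Qed.

Lemma adjC u v : adjacent u v = adjacent v u.
Proof. by rewrite /adj eq_sym distC. Qed.

Lemma run_ssfE act :
  (forall u, (ssf_run act).1 u =
    flatten [seq heard pos alpha beta eps P Noise name (tx_set name F act j) u
            | j <- iota 0 (size F)]) /\
  (ssf_run act).2 = size F.
Proof.
rewrite /run_ssf.
set f := (fun _ _ => _).
have gen s (h : 'I_n -> seq nat) k :
    (forall u, (foldl f (h, k) s).1 u = h u ++
       flatten [seq heard pos alpha beta eps P Noise name (tx_set name F act j) u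
               | j <- s]) /\ (foldl f (h, k) s).2 = (k + size s)%N.
  elim: s h k => [|j s IH] h k /=; first by rewrite addn0; split=> // u; rewrite cats0.
  have [h1 h2] := IH (fun u => h u ++ heard pos alpha beta eps P Noise name (tx_set name F act j) u) k.+1.
  by rewrite h2 addSnnS; split=> // u; rewrite h1 catA.
have [h1 h2] := gen (iota 0 (size F)) (fun=> [::]) 0%N.
by rewrite h2 size_iota; split=> // u; rewrite h1.
Qed.

Lemma hearsP act u :
  reflect (exists2 j, (j < size F)%N & exists v, rcv (tx_set name F act j) v u)
          (hears act u).
Proof.
rewrite (run_ssfE act).1 -size_eq0 -lt0n -has_predT.
apply: (iffP hasP) => [[x /flatten_mapP[j jF /mapP[v]]]|[j jF [v hv]]].
  rewrite mem_iota in jF; rewrite mem_filter => /andP[h _] _.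
  by exists j => //; exists v.
exists (name v) => //; apply/flatten_mapP; exists j; first by rewrite mem_iota.
by apply: map_f; rewrite mem_filter hv mem_enum; case/and4P: hv.
Qed.

Lemma receives_adj act j v u : rcv (tx_set name F act j) v u -> act v /\ adjacent u v.
Proof.
case/and4P; rewrite inE => /andP[av sv] uT dvu _; split=> //.
rewrite /adj distC dvu andbT; apply: contraNneq uT => ->.
by rewrite inE av.
Qed.

Lemma hears_adj act u : hears act u -> exists2 v, act v & adjacent u v.
Proof. by case/hearsP => j _ [v /receives_adj[]]; exists v. Qed.

Definition becomes_leader (st : 'I_n -> status) (c : 'I_n -> bool) (v : 'I_n) :=
  is_worker (st v) && c v &&
  ((ssf_run (fun v => is_worker (st v) && c v)).1 v == [::]).

Lemma nextE st c u :
  let s := if becomes_leader st c u then Leader else st u in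
  next st c u = if is_worker s && hears (becomes_leader st c) u
                then Slave (seq_min ((ssf_run (becomes_leader st c)).1 u)) else s.
Proof. by []. Qed.

Lemma is_leader_next st c u :
  is_leader (next st c u) = is_leader (st u) || becomes_leader st c u.
Proof.
rewrite nextE; case: (becomes_leader st c u) => /=; first by rewrite orbT.
by rewrite orbF; case: (st u) => //=; case: ifP.
Qed.

Lemma is_worker_next st c u :
  is_worker (next st c u) =
  [&& is_worker (st u), ~~ becomes_leader st c u & ~~ hears (becomes_leader st c) u].
Proof.
rewrite nextE; case: (becomes_leader st c u) => /=; first by rewrite andbF.
by case: (st u) => //=; case: ifP.
Qed.

Lemma next_worker_sub st c u : is_worker (next st c u) -> is_worker (st u).
Proof. by rewrite is_worker_next => /andP[]. Qed.

Definition worker_nbrs (st : 'I_n -> status) (u : 'I_n) : {set 'I_n} :=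
  [set w | is_worker (st w) && adjacent u w].

(** The degree bound is strict: [B = 1] says that the workers are pairwise non-adjacent, and
    [B = D.+1] that each has at most [D] worker neighbours. *)
Record mis_inv (B : nat) (st : 'I_n -> status) : Prop := MisInv {
  inv_indep : forall u v, is_leader (st u) -> is_leader (st v) -> ~~ adjacent u v;
  inv_free : forall u v, is_worker (st u) -> is_leader (st v) -> ~~ adjacent u v;
  inv_dom : forall u, ~~ is_worker (st u) -> ~~ is_leader (st u) ->
    exists2 v, is_leader (st v) & adjacent u v;
  inv_deg : forall u, is_worker (st u) -> (#|worker_nbrs st u| < B)%N }.

Lemma mis_inv_leq B B' st : (B <= B')%N -> mis_inv B st -> mis_inv B' st.
Proof. by move=> hB [h1 h2 h3 h4]; split=> // u /h4 h; apply: leq_trans hB. Qed.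

Lemma mis_of_inv B st : mis_inv B st -> (forall u, ~~ is_worker (st u)) ->
  is_mis pos alpha beta eps P Noise [set v | is_leader (st v)].
Proof.
move=> [h1 _ h3 _] nw; apply/andP; split.
  apply/forall_inP => u; rewrite inE => lu.
  by apply/forall_inP => v; rewrite inE => lv; apply: h1.
apply/forall_inP => u; rewrite inE => nlu.
have [v lv uv] := h3 u (nw u) nlu.
by apply/exists_inP; exists v; rewrite ?inE.
Qed.

(** The quantification over subsets [act] of the candidates serves both stages: all candidates
    transmit in the first, only the new leaders in the second. *)
Definition delivers (cand : 'I_n -> bool) (u : 'I_n) : Prop :=
  forall act : 'I_n -> bool, (forall v, act v -> cand v) ->
  forall v, act v -> adjacent u v -> hears act u.

Definition reliable (st : 'I_n -> status) (c : 'I_n -> bool) : Prop :=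
  forall u, is_worker (st u) -> delivers (fun v => is_worker (st v) && c v) u.

(** Reliability is not assumed: reception requires adjacency, so with no candidate neighbour nothing
    can be heard, whatever the interference. *)
Lemma sole_becomes_leader st (c : 'I_n -> bool) u : is_worker (st u) -> c u ->
  (forall w, w \in worker_nbrs st u -> ~~ c w) -> becomes_leader st c u.
Proof.
move=> wu cu hn; rewrite /becomes_leader wu cu /= -[_ == _]negbK.
apply/negP => /hears_adj[v /andP[wv cv] uv].
by have := hn v; rewrite inE wv uv cv => /(_ isT).
Qed.

Lemma leader_nbr_not_worker st c u w : reliable st c ->
  becomes_leader st c w -> adjacent u w -> ~~ is_worker (next st c u).
Proof.
move=> rel lw uw; rewrite is_worker_next.
case wu: (is_worker (st u)) => //=; rewrite negb_and !negbK; apply/orP; right.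
by apply: (rel u wu _ _ w) => // v /andP[].
Qed.

Lemma leader_cand_nbr st (c : 'I_n -> bool) u v : reliable st c -> becomes_leader st c u ->
  is_worker (st v) -> c v -> ~~ adjacent u v.
Proof.
move=> rel /andP[/andP[wu cu] nh] wv cv; apply: contraL nh => uv.
by apply: (rel u wu _ _ v); rewrite ?wv.
Qed.

(** Delivery in the first stage excludes adjacent new leaders; delivery in the second removes their
    neighbours from the workers. A new slave is dominated because whatever it heard came from an
    adjacent new leader. *)
Lemma mis_inv_next B st c : reliable st c -> mis_inv B st -> mis_inv B (next st c).
Proof.
move=> rel [h1 h2 h3 h4].
have bw u : becomes_leader st c u -> is_worker (st u) by case/andP => /andP[].
have bc u : becomes_leader st c u -> c u by case/andP => /andP[].
split.
- move=> u v; rewrite !is_leader_next => /orP[lu|bu] /orP[lv|bv].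
  + exact: h1.
  + by rewrite adjC; apply: h2 lu; apply: bw.
  + by apply: h2 lv; apply: bw.
  + by apply: (leader_cand_nbr rel bu) (bw _ bv) (bc _ bv).
- move=> u v wu; rewrite is_leader_next => /orP[lv|bv].
    exact: h2 (next_worker_sub wu) lv.
  by apply: contraL wu; apply: leader_nbr_not_worker.
- move=> u; rewrite is_worker_next is_leader_next negb_or => hw /andP[nl nb].
  move: hw; rewrite nb /= negb_and negbK => /orP[nw|].
    by have [v lv uv] := h3 u nw nl; exists v; rewrite // is_leader_next lv.
  by case/hears_adj => v bv uv; exists v; rewrite // is_leader_next bv orbT.
- move=> u /next_worker_sub /h4; apply: leq_ltn_trans.
  apply: subset_leq_card; apply/subsetP => w; rewrite !inE => /andP[hw ->].
  by rewrite (next_worker_sub hw).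
Qed.

Lemma worker_nbrs_next st c u :
  (#|worker_nbrs (next st c) u| <= #|worker_nbrs st u|)%N.
Proof.
apply: subset_leq_card; apply/subsetP => w; rewrite !inE => /andP[hw ->].
by rewrite (next_worker_sub hw).
Qed.

Lemma isolated_workers_lead st (c : 'I_n -> bool) u : mis_inv 1 st -> (forall v, c v) ->
  is_worker (st u) -> becomes_leader st c u.
Proof.
move=> inv call wu; apply: sole_becomes_leader => // w.
by move: (inv_deg inv wu); rewrite ltnS leqn0 cards_eq0 => /eqP->; rewrite inE.
Qed.

(** Vacuous: no worker has a worker neighbour from which a message should arrive. *)
Lemma isolated_reliable st c : mis_inv 1 st -> reliable st c.
Proof.
move=> inv u wu act hact v av uv; have /andP[wv _] := hact v av.
have := inv_deg inv wu; rewrite ltnS leqn0 cards_eq0 => /eqP h.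
by have : v \in worker_nbrs st u; [rewrite inE wv | rewrite h inE].
Qed.

Lemma subphase_rounds st c :
  (subphase pos alpha beta eps P Noise name F st c).2 = (size F).*2.
Proof. by rewrite /subphase /= !(run_ssfE _).2 addnn. Qed.

End Subphase.

(** * Interference of random candidates *)

Lemma leq_card_fibers (T K : finType) (f : T -> K) (X : {set T}) (m : nat) :
  (forall k, #|[set x in X | f x == k]| <= m)%N -> (#|X| <= #|K| * m)%N.
Proof.
move=> h; rewrite -sum1_card (partition_big f predT) //= -sum_nat_const.
apply: leq_sum => k _; apply: leq_trans (h k).
by rewrite -sum1_card; under [leqRHS]eq_bigl do rewrite inE.
Qed.

(** The term with [2^j < y <= 2^(j+1)] alone suffices, since [y^(-al) <= (2^j)^(-al)]. *)
Lemma powRN_le_dyadic (R : realType) (al y : R) (J : nat) :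
  0 <= al -> 1 < y -> y <= 2 ^+ J ->
  y `^ (- al) <= \sum_(j < J) (2 `^ (- al)) ^+ j * (y <= 2 ^+ j.+1)%R%:R.
Proof.
move=> al0 y1; elim: J => [|J IH] yJ; first by rewrite expr0 leNgt y1 in yJ.
rewrite big_ord_recr /=; have [h|h] := leP y (2 ^+ J).
  by apply: le_trans (IH h) _; rewrite lerDl mulr_ge0 ?exprn_ge0 ?powR_ge0.
rewrite -[leLHS]add0r; apply: lerD.
  by apply: sumr_ge0 => j _; rewrite mulr_ge0 ?exprn_ge0 ?powR_ge0.
rewrite yJ mulr1 -powR_mulrn ?powR_ge0 // -powRrM mulrC powRrM powR_mulrn //.
rewrite !powRN lef_pV2 ?posrE ?powR_gt0 ?exprn_gt0 //; last by apply: lt_trans y1.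
by rewrite ge0_ler_powR ?nnegrE ?exprn_ge0 // ltW // (lt_trans _ y1).
Qed.

Section Interference.
Variables (R : realType) (n : nat) (pos : 'I_n -> R * R).
Variables (alpha beta eps P Noise : R).

Local Notation R0 := ((1 - eps) * range alpha beta P Noise).
Local Notation adjacent := (adj pos alpha beta eps P Noise).
Local Notation dst := (dist pos).

Hypothesis alpha_gt2 : 2 < alpha.
Hypothesis R0_gt0 : 0 < R0.

(** The ball is covered by [(2A+1)^2] grid cells of side [R0/2]. Two points of a cell are at
    distance at most [R0], so a cell holds at most one node of [W] and its [D] neighbours. *)
Lemma card_ball (W : {set 'I_n}) (D A : nat) (u : 'I_n) :
  (forall v, v \in W -> (#|[set w in W | adjacent v w]| <= D)%N) ->
  (#|[set w in W | (dst w u <= A%:R * (R0 / 2))%R]| <= (2 * A).+1 ^ 2 * D.+1)%N.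
Proof.
move=> hD; set s := R0 / 2; have s0 : 0 < s by rewrite divr_gt0.
(* Grid index of a coordinate offset [d]; the shift by [A] makes it non-negative, and [inord] is
   faithful when [|d| <= A s]. *)
pose cl (d : R) : 'I_(2 * A).+1 := inord (Num.truncn (d / s + A%:R)).
have clP d : `|d| <= A%:R * s -> (cl d)%:R <= d / s + A%:R < (cl d)%:R + 1.
  rewrite ler_norml => /andP[d1 d2].
  have hd1 : - A%:R <= d / s by rewrite ler_pdivlMr // mulNr.
  have hd2 : d / s <= A%:R by rewrite ler_pdivrMr.
  have := @Num.Theory.truncn_itv R (d / s + A%:R).
  have /[swap]/[apply] : 0 <= d / s + A%:R by lra.
  move=> h; rewrite /cl inordK ?natr1 //; move/andP: h => [h _].
  by rewrite ltnS -(ler_nat R) (le_trans h) // natrM; lra.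
have near d d' : `|d| <= A%:R * s -> `|d'| <= A%:R * s -> cl d = cl d' ->
    (d - d') ^+ 2 <= s ^+ 2.
  move=> /clP/andP[h1 h2] /clP/andP[+ +] e; rewrite -e => h3 h4.
  have : `|d / s - d' / s| <= 1 by rewrite ler_norml; lra.
  rewrite -mulrBl normrM [X in _ * X]gtr0_norm ?invr_gt0 // ler_pdivrMr // mul1r.
  by move=> h; rewrite -[leLHS]real_normK ?num_real // lerXn2r ?nnegrE // ltW.
have coord w : dst w u <= A%:R * s ->
    `|(pos w).1 - (pos u).1| <= A%:R * s /\ `|(pos w).2 - (pos u).2| <= A%:R * s.
  move=> h; have hA : 0 <= A%:R * s by rewrite mulr_ge0 // ltW.
  have : ((pos w).1 - (pos u).1) ^+ 2 + ((pos w).2 - (pos u).2) ^+ 2 <= (A%:R * s) ^+ 2.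
    rewrite -[leLHS]sqr_sqrtr ?addr_ge0 ?sqr_ge0 //.
    by rewrite lerXn2r // nnegrE sqrtr_ge0.
  move=> h2; split; rewrite -ler_sqr ?nnegrE ?normr_ge0 // real_normK ?num_real //;
    apply: le_trans h2; rewrite ?lerDl ?lerDr sqr_ge0 //.
pose f w := (cl ((pos w).1 - (pos u).1), cl ((pos w).2 - (pos u).2)).
have -> : ((2 * A).+1 ^ 2 = #|{: 'I_(2 * A).+1 * 'I_(2 * A).+1}|)%N.
  by rewrite card_prod card_ord expnS expn1.
apply: (@leq_card_fibers _ _ f) => k.
set Y := [set x in _ | _].
have [->|[v vY]] := set_0Vmem Y; first by rewrite cards0.
have YW w : w \in Y -> [/\ w \in W, dst w u <= A%:R * s & f w = k].
  by rewrite !inE => /andP[/andP[-> ->] /eqP->].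
have [vW vu fv] := YW v vY.
apply: (@leq_trans #|v |: [set w in W | adjacent v w]|); last first.
  by rewrite cardsU1 -add1n leq_add ?leq_b1 ?hD.
apply: subset_leq_card; apply/subsetP => w /YW[wW wu fw].
rewrite !inE wW eq_sym /adj /=; case: eqP => //= _.
have [v1 v2] := coord v vu; have [w1 w2] := coord w wu.
move: fw; rewrite -fv => -[/esym e1 /esym e2].
have := near _ _ v1 w1 e1; have := near _ _ v2 w2 e2.
rewrite !opprB !addrA !subrK => n2 n1.
rewrite -(ger0_norm (ltW R0_gt0)) -sqrtr_sqr; apply: ler_wsqrtr.
have -> : R0 = s + s by rewrite /s; lra.
have : 0 < s * s by rewrite mulr_gt0.
move: n1 n2; rewrite !expr2; nra.
Qed.

Variables (W : {set 'I_n}) (D B : nat) (u : 'I_n).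
Hypothesis W_deg : forall v, v \in W -> (#|[set w in W | adjacent v w]| <= D)%N.
Hypothesis D_gt0 : (0 < D)%N.
Hypothesis B_gt0 : (0 < B)%N.
Local Notation rho := (B%:R * (R0 / 2)).

Definition near_ind (v : 'I_n) : R := ((v \in W) && (dst v u <= rho)%R)%:R.

(** Received power relative to that at distance [rho]; this scaling puts the values in [[0, 1]], as
    the Chernoff bound demands. *)
Definition far_gain (v : 'I_n) : R :=
  if (v \in W) && (rho < dst v u)%R then (dst v u / rho) `^ (- alpha) else 0.

Let rho_gt0 : 0 < rho.
Proof. by rewrite mulr_gt0 ?ltr0n // divr_gt0. Qed.

Lemma near_ind01 v : 0 <= near_ind v <= 1.
Proof. by rewrite /near_ind ler0n lern1 leq_b1. Qed.

Lemma far_gain01 v : 0 <= far_gain v <= 1.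
Proof.
rewrite /far_gain; case: ifP => [/andP[_ h]|_]; last by rewrite lexx ler01.
rewrite powR_ge0 powRN invf_le1 ?powR_gt0 ?divr_gt0 //; last exact: lt_trans h.
have a0 : 0 <= alpha by move: alpha_gt2; lra.
by rewrite -[leLHS](powRr0 (dst v u / rho)) ler_powR // ler_pdivlMr // mul1r ltW.
Qed.

Let invD_D1 : D%:R^-1 * D.+1%:R <= 2 :> R.
Proof.
have : 1 <= D%:R :> R by rewrite ler1n.
by rewrite mulrC => h; rewrite ler_pdivrMr ?ltr0n // -natr1; lra.
Qed.

(** The constant is [(2B+1)^2 <= 9 B^2] times [(D+1)/D <= 2]. *)
Lemma near_mean : D%:R^-1 * \sum_v near_ind v <= 18 * B%:R ^+ 2.
Proof.
have -> : \sum_v near_ind v = #|[set w in W | (dst w u <= rho)%R]|%:R.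
  rewrite -sum1_card natr_sum [RHS]big_mkcond /=; apply: eq_bigr => v _.
  by rewrite /near_ind inE; case: andb.
have := card_ball B u W_deg; rewrite -(ler_nat R) natrM natrX.
have hB : 1 <= B%:R :> R by rewrite ler1n.
have hD : 0 < D%:R^-1 :> R by rewrite invr_gt0 ltr0n.
move: invD_D1; set q := D%:R^-1 in hD *; set e := D.+1%:R; set N := #|_|%:R.
have -> : (2 * B).+1%:R = 2 * B%:R + 1 :> R by rewrite -natr1 natrM.
set b := B%:R in hB *.
move=> h1 h2.
apply: (@le_trans _ _ (q * ((2 * b + 1) ^+ 2 * e))); first by rewrite ler_wpM2l // ltW.
rewrite mulrCA; apply: (@le_trans _ _ ((2 * b + 1) ^+ 2 * 2)).
  by rewrite ler_wpM2l // sqr_ge0.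
rewrite !expr2; nra.
Qed.

(** At scale [j] at most about [4^j B^2 D] nodes gain at most [2^(-alpha j)] each, which gives a
    geometric series of ratio [2^(2 - alpha) < 1]. The factor [50] is [25 * 2], from
    [(4y+1)^2 <= 25 y^2] for [y >= 1] and [(D+1)/D <= 2]. *)
Lemma far_mean :
  D%:R^-1 * \sum_v far_gain v <= 50 / (1 - 2 `^ (2 - alpha)) * B%:R ^+ 2.
Proof.
set z : R := 2 `^ (2 - alpha).
have z0 : 0 <= z by apply: powR_ge0.
have z1 : z < 1.
  rewrite /z /powR pnatr_eq0 expR_lt1 pmulr_llt0 ?ln_gt0 ?ltr1n //.
  by rewrite subr_lt0.
have zE : z = 4 * 2 `^ (- alpha).
  by rewrite /z powRD ?pnatr_eq0 ?implybT // powR_mulrn // -natrX.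
have [J hJ] : exists J, forall v, dst v u / rho <= 2 ^+ J.
  pose M := \sum_v dst v u / rho.
  exists (Num.truncn M).+1 => v.
  apply: (@le_trans _ _ M).
    rewrite /M (bigD1 v) //= lerDl sumr_ge0 // => w _.
    by rewrite divr_ge0 ?sqrtr_ge0 // ltW.
  apply: (@le_trans _ _ (Num.truncn M).+1%:R); first by rewrite ltW // truncnS_gt.
  by rewrite -natrX ler_nat ltnW // ltn_expl.
have hD : 0 <= D%:R^-1 :> R by rewrite invr_ge0.
have hj (j : nat) :
    D%:R^-1 * #|[set w in W | (dst w u <= (B * 2 ^ j.+1)%:R * (R0 / 2))%R]|%:R
    <= 50 * B%:R ^+ 2 * 4 ^+ j :> R.
  have h2 := card_ball (B * 2 ^ j.+1) u W_deg.
  move: h2; set N := #|_| => h2; rewrite -(ler_nat R) natrM natrX in h2.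
  have hB : 1 <= B%:R * 2 ^+ j :> R.
    by rewrite -natrX -natrM ler1n muln_gt0 B_gt0 expn_gt0.
  have -> : 50 * B%:R ^+ 2 * 4 ^+ j = 50 * (B%:R * 2 ^+ j) ^+ 2 :> R.
    have -> : 4 ^+ j = (2 ^+ j) ^+ 2 :> R by rewrite exprAC -[in RHS]natrX.
    by ring.
  have eA : (2 * (B * 2 ^ j.+1)).+1%:R = 4 * (B%:R * 2 ^+ j) + 1 :> R.
    by rewrite -natr1 !natrM natrX exprS; ring.
  rewrite eA in h2; move: h2 hB; set b := B%:R * 2 ^+ j => h2 hB.
  apply: (le_trans (ler_wpM2l hD h2)); rewrite mulrCA.
  apply: (le_trans (ler_wpM2l (sqr_ge0 _) invD_D1)).
  by rewrite !expr2; nra.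
apply: (@le_trans _ _ (\sum_(j < J) 50 * B%:R ^+ 2 * z ^+ j)); last first.
  rewrite -mulr_sumr mulrAC ler_wpM2r ?sqr_ge0 //.
  rewrite ler_wpM2l // -[leRHS]mul1r ler_pdivlMr ?subr_gt0 // mulrC.
  by rewrite -opprB mulNr -subrX1 opprB gerBl exprn_ge0.
apply: (@le_trans _ _ (D%:R^-1 * \sum_v \sum_(j < J)
    (2 `^ (- alpha)) ^+ j * ((v \in W) && (dst v u <= (B * 2 ^ j.+1)%:R * (R0 / 2))%R)%:R)).
  rewrite ler_wpM2l ?invr_ge0 //; apply: ler_sum => v _.
  rewrite /far_gain; case: ifP => [/andP[vW hv]|_]; last first.
    by apply: sumr_ge0 => j _; rewrite mulr_ge0 ?exprn_ge0 ?powR_ge0.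
  apply: le_trans (powRN_le_dyadic _ _ (hJ v)) _; 
    [by move: alpha_gt2; lra|by rewrite ltr_pdivlMr ?mul1r|].
  apply: ler_sum => j _; rewrite vW ler_wpM2l ?exprn_ge0 ?powR_ge0 //.
  by rewrite ler_pdivrMr // natrM natrX mulrCA -[B%:R * _ * _]mulrA.
rewrite exchange_big mulr_sumr; apply: ler_sum => j _ /=.
rewrite -mulr_sumr mulrCA zE exprMn [_ * (4 ^+ _ * _)]mulrA [leRHS]mulrC.
rewrite ler_wpM2l ?exprn_ge0 ?powR_ge0 //; apply: le_trans (hj j).
rewrite ler_wpM2l ?invr_ge0 // -sum1_card natr_sum [leRHS]big_mkcond /=.
by apply: ler_sum => v _; rewrite inE; case: andb.
Qed.

End Interference.

(** * Jamming probability and delivery in its absence *)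

Section Reception.
Variables (R : realType) (n : nat) (pos : 'I_n -> R * R).
Variables (alpha beta eps P Noise : R) (name : 'I_n -> nat).
Variable F : seq (nat -> bool).

Local Notation R0 := ((1 - eps) * range alpha beta P Noise).
Local Notation adjacent := (adj pos alpha beta eps P Noise).
Local Notation dst := (dist pos).
Local Notation near := (near_ind pos alpha beta eps P Noise).
Local Notation far := (far_gain pos alpha beta eps P Noise).

Hypothesis alpha_gt2 : 2 < alpha.
Hypothesis R0_gt0 : 0 < R0.

Definition jammed (W : {set 'I_n}) (B x : nat) (t : R) (u : 'I_n)
    (c : {ffun 'I_n -> bool}) : bool :=
  (x%:R < \sum_(v | c v) near W B u v) || (t < \sum_(v | c v) far W B u v).

(** Both thresholds exceed twice the mean by enough for Chernoff: the exponents are at most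
    [18 B^2 - 19 B^2] and, with [g = 1 / (1 - 2^(2 - alpha)) >= 1], [50 g B^2 - 100 g B^2]. *)
Lemma jammed_prob (W : {set 'I_n}) (D B x : nat) (t : R) (u : 'I_n) :
  (forall v, v \in W -> (#|[set w in W | adjacent v w]| <= D)%N) ->
  (0 < D)%N -> (0 < B)%N -> (38 * B ^ 2 <= x)%N ->
  200 / (1 - 2 `^ (2 - alpha)) * B%:R ^+ 2 <= t ->
  coin_mean (D%:R^-1 : R) (fun c => (jammed W B x t u c)%:R) <= 2 * expR (- B%:R ^+ 2).
Proof.
move=> hW D0 B0 hx ht.
have p01 : 0 <= (D%:R^-1 : R) <= 1.
  by rewrite invr_ge0 ler0n invf_le1 ?ltr0n // ler1n.
apply: (@le_trans _ _ (coin_mean (D%:R^-1 : R) (fun c =>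
    (x%:R < \sum_(v | c v) near W B u v)%R%:R +
    (t < \sum_(v | c v) far W B u v)%R%:R))).
  apply: ler_coin_mean => // c; rewrite /jammed -natrD ler_nat.
  by case: (_ < _) (_ < _) => -[].
rewrite coin_meanD mulrDl mul1r; apply: lerD.
  apply: le_trans (coin_chernoff p01 x%:R (near_ind01 pos alpha beta eps P Noise W B u)
    (near_mean R0_gt0 u hW D0 B0)) _.
  move: hx; rewrite -(ler_nat R) natrM natrX ler_expR; lra.
apply: le_trans (coin_chernoff p01 t (far_gain01 pos alpha_gt2 R0_gt0 W u B0)
  (far_mean alpha_gt2 R0_gt0 u hW D0 B0)) _.
rewrite ler_expR.
have z1 : 2 `^ (2 - alpha) < 1.
  by rewrite /powR pnatr_eq0 expR_lt1 pmulr_llt0 ?ln_gt0 ?ltr1n // subr_lt0.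
have g1 : 1 <= (1 - 2 `^ (2 - alpha))^-1.
  by rewrite invf_ge1 ?subr_gt0 // gerBl powR_ge0.
have b0 := sqr_ge0 (B%:R : R).
have := ler_wpM2r b0 g1; move: ht b0; rewrite -!mulrA.
set g := (1 - _)^-1; rewrite !mul1r; set b := _ ^+ 2; lra.
Qed.

Hypothesis pos_inj : injective pos.
Hypothesis P_gt0 : 0 < P.
Hypothesis Noise_gt0 : 0 < Noise.
Hypothesis beta_gt0 : 0 < beta.

Lemma dist_gt0 u v : u != v -> 0 < dst u v.
Proof.
move=> uv; rewrite /dist sqrtr_gt0 lt0r addr_ge0 ?sqr_ge0 // andbT.
rewrite paddr_eq0 ?sqr_ge0 // !sqrf_eq0 !subr_eq0.
apply: contraNN uv => /andP[/eqP h1 /eqP h2]; apply/eqP/pos_inj.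
by case: (pos u) (pos v) h1 h2 => [? ?] [? ?] /= -> ->.
Qed.

Hypothesis name_inj : injective name.

(* [tau] is the tolerable interference measured in units of the power received
   at distance [R0 / 2]. *)
Lemma not_jammed_delivers (N x B : nat) (tau : R) (W : {set 'I_n}) (u : 'I_n)
    (c : {ffun 'I_n -> bool}) :
  (forall v, (0 < name v <= N)%N) -> is_ssf N x F -> (2 <= B)%N ->
  beta * (Noise + tau * (P * (R0 / 2) `^ (- alpha))) <= P * R0 `^ (- alpha) ->
  ~~ jammed W B x (tau * B%:R `^ alpha) u c ->
  delivers pos alpha beta eps P Noise name F (fun v => (v \in W) && c v) u.
Proof.
move=> nameN [_ ssf] B2 hsig; rewrite /jammed negb_or -!leNgt => /andP[hnear hfar].
move=> act hact v av uv.
have s0 : 0 < R0 / 2 by rewrite divr_gt0.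
set rho := B%:R * (R0 / 2).
have b0 : 0 < B%:R :> R by rewrite ltr0n; apply: leq_trans B2.
have rho0 : 0 < rho by rewrite mulr_gt0.
have R0rho : R0 <= rho.
  have : 2 <= B%:R :> R by rewrite ler_nat.
  move=> h; rewrite /rho; have := ler_wpM2r (ltW s0) h; lra.
have /andP[unv duv] := uv; rewrite distC in duv.
(* The ssf is applied to all nearby candidates, active or not. In the round isolating [v] among
   them, every other transmitter is farther than [rho] from [u]. *)
pose NC := [set w | [&& w \in W, c w & dst w u <= rho]].
have NCx : (#|NC| <= x)%N.
  rewrite -(ler_nat R); apply: le_trans hnear.
  rewrite -sum1_card natr_sum [leLHS]big_mkcond [leRHS]big_mkcond /=.
  apply: ler_sum => w _; rewrite inE /near_ind -/rho.
  by case: (w \in W) (c w) (dst w u <= rho) => -[] [] //=; rewrite ler01.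
have vNC : v \in NC.
  by have /andP[vW cv] := hact v av; rewrite inE vW cv (le_trans duv).
have nm : name v \in map name (enum NC) by rewrite map_f ?mem_enum.
have [] := ssf (map name (enum NC)) _ _ _ (name v) nm.
- by rewrite map_inj_uniq ?enum_uniq.
- by apply/allP => y /mapP[w _ ->].
- by rewrite size_map -cardE NCx andbT; apply/card_gt0P; exists v.
move=> j jF hj; apply/hearsP; exists j => //; exists v.
have hj' w : w \in NC -> ssf_set F j (name w) = (w == v).
  by move=> wNC; rewrite /ssf_set hj ?map_f ?mem_enum // inj_eq.
have vT : v \in tx_set name F act j by rewrite inE av hj' // eqxx.
have outside w : act w -> ssf_set F j (name w) -> w != v -> rho < dst w u.
  move=> aw sw wv; rewrite ltNge; apply/negP => h.
  have /andP[wW cw] := hact w aw.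
  by move: sw; rewrite hj' ?(negbTE wv) // inE wW cw.
apply/and4P; split=> //.
  (* A transmitting [u] would be another transmitter, at distance [0] from itself. *)
  apply/negP; rewrite inE => /andP[au su].
  have := outside u au su unv; rewrite /dist !subrr !expr0n addr0 sqrtr0.
  by rewrite ltNge ltW.
have dvu0 : 0 < dst v u by apply: dist_gt0; rewrite eq_sym.
have den0 : 0 < Noise + \sum_(w in tx_set name F act j | w != v) P * dst w u `^ (- alpha).
  rewrite ltr_wpDr // sumr_ge0 // => w _.
  by rewrite mulr_ge0 ?powR_ge0 // ltW.
rewrite ler_pdivlMr //; apply: (@le_trans _ _ (P * R0 `^ (- alpha))); last first.
  rewrite ler_pM2l // !powRN lef_pV2 ?posrE ?powR_gt0 //.
  by apply: ge0_ler_powR => //; [move: alpha_gt2; lra|exact: ltW|exact: ltW].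
apply: le_trans hsig; rewrite ler_pM2l // lerD2l.
(* In absolute units the bound on the far gain reads [P rho^(-alpha) tau B^alpha], which is
   [tau P (R0/2)^(-alpha)]. *)
apply: (@le_trans _ _ (P * rho `^ (- alpha) * \sum_(w | c w) far W B u w)); last first.
  apply: (@le_trans _ _ (P * rho `^ (- alpha) * (tau * B%:R `^ alpha))).
    by rewrite ler_wpM2l // mulr_ge0 ?powR_ge0 // ltW.
  rewrite /rho (powRM _ (ltW b0) (ltW s0)) (powRN B%:R).
  have : B%:R `^ alpha != 0 :> R by rewrite gt_eqF // powR_gt0.
  move: (_ `^ alpha) (_ `^ (- alpha)) => y z y0.
  by rewrite [leLHS](_ : _ = tau * (P * z)) //; field.
rewrite mulr_sumr [leLHS]big_mkcond [leRHS]big_mkcond /=.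
apply: ler_sum => w _.
have far0 : 0 <= far W B u w by rewrite /far_gain; case: ifP => // _; apply: powR_ge0.
case: ifP => [/andP[+ wv]|_]; last first.
  by case: ifP => // _; rewrite !mulr_ge0 ?powR_ge0 // ltW.
rewrite inE => /andP[aw sw]; have /andP[wW cw] := hact w aw.
have ho := outside w aw sw wv.
rewrite cw /far_gain -/rho wW ho -mulrA -(powRM _ (ltW rho0)).
  by rewrite mulrCA divff ?gt_eqF // mulr1.
by rewrite divr_ge0 ?sqrtr_ge0 // ltW.
Qed.

End Reception.

(** * Failure probability of the phases *)

Section Phase.
Variables (R : realType) (n : nat) (pos : 'I_n -> R * R).
Variables (alpha beta eps P Noise : R) (name : 'I_n -> nat).
Variable F : seq (nat -> bool).

Local Notation adjacent := (adj pos alpha beta eps P Noise).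
Local Notation next st c := (subphase pos alpha beta eps P Noise name F st c).1.
Local Notation nbrs := (worker_nbrs pos alpha beta eps P Noise).
Local Notation leads := (becomes_leader pos alpha beta eps P Noise name F).
Local Notation Inv := (mis_inv pos alpha beta eps P Noise).
Local Notation is_reliable := (reliable pos alpha beta eps P Noise name F).

Let workers (st : 'I_n -> status) : {set 'I_n} := [set v | is_worker (st v)].

Variable jam : {set 'I_n} -> 'I_n -> {ffun 'I_n -> bool} -> bool.
Variable b : R.
Hypothesis b_ge0 : 0 <= b.
Hypothesis jam_prob : forall (W : {set 'I_n}) (u : 'I_n) (D : nat),
  (forall v, v \in W -> (#|[set w in W | adjacent v w]| <= D)%N) -> (0 < D)%N ->
  coin_mean (D%:R^-1 : R) (fun c => (jam W u c)%:R) <= b.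
Hypothesis jam_delivers : forall (W : {set 'I_n}) (u : 'I_n) (c : {ffun 'I_n -> bool}),
  ~~ jam W u c ->
  delivers pos alpha beta eps P Noise name F (fun v => (v \in W) && c v) u.

Definition clear st (c : {ffun 'I_n -> bool}) := [forall u in workers st, ~~ jam (workers st) u c].

Lemma clear_reliable st c : clear st c -> is_reliable st c.
Proof.
move=> /forall_inP h u wu act hact v av uv.
have := @jam_delivers (workers st) u c; rewrite h ?inE // => /(_ isT) hd.
by apply: hd av uv => w /hact; rewrite inE.
Qed.

Variable k : nat.
Let D : nat := (2 ^ k.+1)%N.
Let p : R := D%:R^-1.

Let D_gt0 : (0 < D)%N. Proof. by rewrite expn_gt0. Qed.
Let p_gt0 : 0 < p. Proof. by rewrite invr_gt0 ltr0n. Qed.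
Let p_le1 : p <= 1. Proof. by rewrite invf_le1 ?ltr0n // ler1n. Qed.
Let p01 : 0 <= p <= 1. Proof. by rewrite (ltW p_gt0). Qed.

Let exp_lb m : (m <= D)%N -> 4^-1 <= (1 - p) ^+ m.
Proof.
move=> mD; apply: (@le_trans _ _ ((1 - p) ^+ D)).
  by rewrite /p /D natrX; apply: one_sub_inv_pow2_exp.
by apply: ler_wiXn2l => //; rewrite ?subr_ge0 // gerBl ltW.
Qed.

Let mean_sub1 (f : {ffun 'I_n -> bool} -> R) :
  coin_mean p (fun c => 1 - f c) = 1 - coin_mean p f.
Proof.
rewrite -[X in _ = X - _](@coin_mean_cst R 'I_n p 1) -mulN1r -coin_meanZ -coin_meanD.
by apply: eq_coin_mean => c; rewrite mulN1r.
Qed.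

(** With probability at least [p (1-p)^D >= p/4] the worker is the only candidate in its
    neighbourhood and becomes a leader, even in a jammed sub-phase. *)
Lemma worker_stays_prob st u : is_worker (st u) -> (#|nbrs st u| <= D)%N ->
  coin_mean p (fun c => (is_worker (next st c u))%:R) <= 1 - p / 4.
Proof.
move=> wu hD.
apply: (@le_trans _ _ (coin_mean p (fun c =>
    1 - (c u && [forall v in nbrs st u, ~~ c v])%:R))).
  apply: ler_coin_mean => // c.
  case: andP => [[cu /forall_inP hn]|_]; last by rewrite subr0 lern1 leq_b1.
  have bl : leads st c u by apply: sole_becomes_leader.
  by rewrite is_worker_next bl andbF subrr.
rewrite mean_sub1 coin_mean_sole; last by rewrite inE /adj eqxx andbF.
by rewrite lerB // (ler_wpM2l (ltW p_gt0)) ?exp_lb.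
Qed.

(** Each of at least [D/2] neighbours is a sole candidate with probability at least
    [p (1-p)^(2D) >= p/16], in total [1/32]. Clearness lets the resulting leader reach [u]. *)
Lemma crowded_worker_stays_prob st u : is_worker (st u) ->
  (forall v, is_worker (st v) -> (#|nbrs st v| <= D)%N) ->
  (2 ^ k <= #|nbrs st u|)%N ->
  coin_mean p (fun c => (is_worker (next st c u) && clear st c)%:R) <= 31 / 32.
Proof.
move=> wu hD hk.
(* Adding the neighbours of [u] to those of [w] makes the events [E w] disjoint,
   so that their probabilities add up. *)
pose A w := (nbrs st u :|: nbrs st w) :\ w.
pose E w (c : {ffun 'I_n -> bool}) := c w && [forall v in A w, ~~ c v].
apply: (@le_trans _ _ (coin_mean p (fun c =>
    1 - \sum_(w in nbrs st u) (E w c)%:R))).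
  apply: ler_coin_mean => // c.
  have [w /andP[wN Ew]|none] := pickP (fun w => (w \in nbrs st u) && E w c); last first.
    rewrite big1 ?subr0 ?lern1 ?leq_b1 // => w wN.
    by have := none w; rewrite wN /= => ->.
  have /andP[cw /forall_inP hn] := Ew.
  have nc v : v \in A w -> ~~ c v by apply: hn.
  rewrite (bigD1 w) //= Ew big1 => [|v /andP[vN vw]]; last first.
    by rewrite /E (negbTE (nc v _)) // !inE vw; move: vN; rewrite inE => ->.
  rewrite addr0 subrr lern0 eqb0; apply/negP => /andP[wn /clear_reliable rel].
  move: (wN); rewrite inE => /andP[ww uw].
  move: wn; apply/negP; apply: leader_nbr_not_worker rel _ uw.
  apply: sole_becomes_leader => // v hv; apply: nc; rewrite in_setD1 in_setU hv orbT andbT.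
  by apply: contraTneq hv => ->; rewrite inE /adj eqxx andbF.
rewrite mean_sub1 coin_mean_sum.
have -> : 31 / 32 = 1 - 32^-1 :> R by lra.
rewrite lerB //.
apply: (@le_trans _ _ (\sum_(w in nbrs st u) p / 16)); last first.
  apply: ler_sum => w wN; have ww : is_worker (st w) by move: wN; rewrite inE => /andP[].
  rewrite coin_mean_sole ?setD11 // (ler_wpM2l (ltW p_gt0)) //.
  have cA : (#|A w| <= D + D)%N.
    apply: leq_trans (leq_add (hD u wu) (hD w ww)).
    apply: leq_trans (subset_leq_card (subsetDl _ _)) _.
    by rewrite -cardsUI leq_addr.
  apply: (@le_trans _ _ ((1 - p) ^+ (D + D))); last first.
    by apply: ler_wiXn2l => //; rewrite ?subr_ge0 // gerBl ltW.
  have := exp_lb (leqnn D); rewrite exprD; nra.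
rewrite sumr_const -[leRHS]mulr_natl.
apply: (@le_trans _ _ ((2 ^ k)%:R * (p / 16))); last first.
  by rewrite ler_wpM2r ?ler_nat // divr_ge0 // (ltW p_gt0).
rewrite /p /D expnS natrM invfM.
have : (2 ^ k)%:R != 0 :> R by rewrite pnatr_eq0 expn_eq0.
by move=> h; rewrite [leRHS](_ : _ = 32^-1) //; field.
Qed.

(* [b * 4 * D] is the jamming probability [b] divided by the probability
   [p / 4 = 1 / (4 D)] of leaving the worker status: it pays for the jamming
   risk of a worker over all remaining sub-phases, whatever their number.  Hence
   [b] need not depend on the length of the phase, i.e. [c1] not on [C]. *)
Definition fail_bound (j : nat) (st : 'I_n -> status) : R :=
  \sum_(u | is_worker (st u))
    ((2 ^ k <= #|nbrs st u|)%N%:R * (31 / 32) ^+ j + b * 4 * D%:R).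

(** Induction on the remaining sub-phases: [g] is the failure probability of what follows the phase,
    at most [tau] once the degrees are halved, and [fail_bound] covers the failure to halve them. *)
Lemma phase_fail (j : nat) (g : ('I_n -> status) -> R) (tau : R) st :
  (forall st, g st <= 1) -> 0 <= tau ->
  (forall st, Inv (2 ^ k) st -> g st <= tau) ->
  Inv D.+1 st ->
  seq_mean (fun st c => next st c) (nseq j p) g st <= tau + fail_bound j st.
Proof.
move=> g1 tau0 gtau; have bD : 0 <= b * 4 * D%:R by rewrite !mulr_ge0.
have lam0 i : 0 <= (31 / 32) ^+ i :> R by rewrite exprn_ge0 //; lra.
elim: j st => [|j IH] st inv.
  rewrite /= /fail_bound.
  (* A crowded worker makes [fail_bound] at least [1]; without one, the halved degree bound
     holds. *)
  have [u /andP[wu hu]|none] := pickP (fun u => is_worker (st u) && (2 ^ k <= #|nbrs st u|)%N).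
    rewrite (bigD1 u) //= hu expr0 mulr1 /=; apply: (le_trans (g1 st)).
    have : 0 <= \sum_(v | is_worker (st v) && (v != u))
        ((2 ^ k <= #|nbrs st v|)%N%:R * (31 / 32) ^+ 0 + b * 4 * D%:R) :> R.
      by apply: sumr_ge0 => v _; rewrite addr_ge0 // mulr_ge0.
    by move: bD; rewrite expr0 => *; lra.
  apply: (@le_trans _ _ tau).
    apply: gtau; case: inv => h1 h2 h3 _; split=> // u wu.
    by rewrite ltnNge; apply/negP => hu; have := none u; rewrite wu hu.
  by rewrite lerDl sumr_ge0 // => u _; rewrite addr_ge0 // mulr_ge0.
have deg u : is_worker (st u) -> (#|nbrs st u| <= D)%N.
  by move=> wu; rewrite -ltnS (inv_deg inv wu).
pose big u : R := (2 ^ k <= #|nbrs st u|)%N%:R.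
(* [Z] covers both outcomes: in a clear sub-phase it dominates the next [fail_bound] term by term,
   otherwise the jam indicator of some worker already gives [1]. *)
pose Z (c : {ffun 'I_n -> bool}) : R := \sum_(u | is_worker (st u))
  (big u * (31 / 32) ^+ j * (is_worker (next st c u) && clear st c)%:R
   + (b * 4 * D%:R * (is_worker (next st c u))%:R + (jam (workers st) u c)%:R)).
have Zterm0 (c : {ffun 'I_n -> bool}) u : 0 <= big u * (31 / 32) ^+ j * (is_worker (next st c u) && clear st c)%:R
   + (b * 4 * D%:R * (is_worker (next st c u))%:R + (jam (workers st) u c)%:R).
  by rewrite !addr_ge0 // !mulr_ge0.
apply: (@le_trans _ _ (coin_mean p (fun c => tau + Z c))).
  apply: ler_coin_mean => // c; case cl: (clear st c).
    apply: le_trans (IH _ (mis_inv_next (clear_reliable cl) inv)) _.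
    rewrite lerD2l /fail_bound /Z big_mkcond [leRHS]big_mkcond.
    apply: ler_sum => u _; case: ifP => [wn|wn]; last first.
      by case: ifP => // _; have := Zterm0 c u; rewrite wn.
    rewrite (next_worker_sub wn) cl /= !mulr1 -[leLHS]addr0 addrA.
    rewrite lerD // lerD2r ler_wpM2r // ler_nat.
    have := worker_nbrs_next pos alpha beta eps P Noise name F st c u.
    case: (leqP (2 ^ k) #|nbrs (next _ _) _|) => // h1 h2.
    by rewrite (leq_trans h1 h2).
  apply: (@le_trans _ _ 1).
    by apply: seq_mean_le1 => //; apply/allP => q /nseqP[-> _].
  move/negbT: cl => /forall_inPn[u]; rewrite inE negbK => wu ju.
  rewrite /Z (bigD1 u) //= ju /=.
  have : 0 <= \sum_(v | is_worker (st v) && (v != u))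
      (big v * (31 / 32) ^+ j * (is_worker (next st c v) && clear st c)%:R
       + (b * 4 * D%:R * (is_worker (next st c v))%:R + (jam (workers st) v c)%:R)).
    by apply: sumr_ge0.
  have : 0 <= big u * (31 / 32) ^+ j * (is_worker (next st c u) && clear st c)%:R.
    by rewrite !mulr_ge0.
  have : 0 <= b * 4 * D%:R * (is_worker (next st c u))%:R by rewrite mulr_ge0.
  lra.
rewrite coin_meanD coin_mean_cst lerD2l coin_mean_sum /fail_bound.
apply: ler_sum => u wu; rewrite !coin_meanD !coin_meanZ addrA.
have jp : coin_mean p (fun c => (jam (workers st) u c)%:R) <= b.
  apply: jam_prob => // v; rewrite inE => wv; apply: leq_trans (deg v wv).
  by apply: subset_leq_card; apply/subsetP => w; rewrite !inE.
have stay := ler_wpM2l bD (worker_stays_prob wu (deg u wu)).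
(* The expected loss of the reserve [4 b D] is exactly [b], which pays for jamming in this
   sub-phase. *)
have pD : b * 4 * D%:R * (1 - p / 4) = b * 4 * D%:R - b.
  by rewrite /p; field; rewrite pnatr_eq0 -lt0n.
have crowd : big u * (31 / 32) ^+ j *
    coin_mean p (fun c => (is_worker (next st c u) && clear st c)%:R) <=
    big u * (31 / 32) ^+ j.+1.
  rewrite exprSr [leRHS]mulrA; case hu: (2 ^ k <= #|nbrs st u|)%N; last first.
    by rewrite /big hu !mul0r.
  by rewrite ler_wpM2l ?mulr_ge0 // crowded_worker_stays_prob.
rewrite -/(big u); lra.
Qed.

End Phase.

(** * Composition of the phases *)

Section Procedure.
Variables (R : realType) (n : nat) (pos : 'I_n -> R * R).
Variables (alpha beta eps P Noise : R) (name : 'I_n -> nat).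
Variable F : seq (nat -> bool).

Local Notation next st c := (subphase pos alpha beta eps P Noise name F st c).1.
Local Notation Inv := (mis_inv pos alpha beta eps P Noise).
Local Notation nbrs := (worker_nbrs pos alpha beta eps P Noise).
Local Notation step := (fun st (c : {ffun 'I_n -> bool}) => next st c).
Local Notation run := (mis_swd pos alpha beta eps P Noise name F).

Definition mis_fail (st : 'I_n -> status) : R :=
  (~~ is_mis pos alpha beta eps P Noise [set v | is_leader (st v)])%:R.

Lemma mis_swd_rounds d m (omega : {ffun ('I_d.+1 * 'I_m) * 'I_n -> bool}) :
  (run omega).2 = (d.+1 * m * (size F).*2)%N.
Proof.
rewrite /mis_swd; set f := (f in foldl f).
have gen s acc : (foldl f acc s).2 = (acc.2 + size s * (size F).*2)%N.
  elim: s acc => [|ij s IH] acc; first by rewrite addn0.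
  rewrite -[foldl f acc (ij :: s)]/(foldl f (f acc ij) s) IH.
  have -> : (f acc ij).2 = (acc.2 + (size F).*2)%N.
    by rewrite -(subphase_rounds pos alpha beta eps P Noise name F acc.1 (fun v => omega (ij, v))).
  by rewrite mulSn addnA.
by rewrite gen add0n size_allpairs !size_enum_ord.
Qed.

Lemma mis_swd_foldl d m (omega : {ffun ('I_d.+1 * 'I_m) * 'I_n -> bool}) :
  (run omega).1 =
  foldl (fun st t => step st (coins_at omega t)) (fun=> Worker)
        [seq (i, j) | i <- enum 'I_d.+1, j <- enum 'I_m].
Proof.
rewrite /mis_swd; set f := (f in (foldl f _ _).1).
have gen s acc : (foldl f acc s).1 =
    foldl (fun st t => step st (coins_at omega t)) acc.1 s.
  elim: s acc => // t s IH acc.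
  rewrite -[foldl f acc (t :: s)]/(foldl f (f acc t) s) IH.
  have -> // : (f acc t).1 = step acc.1 (coins_at omega t).
  rewrite -[LHS]/(next acc.1 (fun v => omega (t, v))).
  by congr (next _ _); apply: boolp.funext => v; rewrite ffunE.
exact: gen.
Qed.

(** Phase [i] is indexed by [e = d - i], its probability being [2^(-e)]; the first phase can then be
    peeled off by recursion on [e]. *)
Definition level_probs (m e : nat) : seq R :=
  flatten [seq nseq m ((2 ^ i)%N%:R^-1) | i <- rev (iota 0 e.+1)].

Lemma level_probsS m e :
  level_probs m e.+1 = nseq m ((2 ^ e.+1)%N%:R^-1) ++ level_probs m e.
Proof. by rewrite /level_probs -[e.+2]addn1 iotaD rev_cat. Qed.

Lemma schedule_probs d m :
  [seq cand_prob R t.1 | t <- [seq (i, j) | i <- enum 'I_d.+1, j <- enum 'I_m]] =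
  level_probs m d.
Proof.
rewrite map_flatten -map_comp /level_probs.
have -> : rev (iota 0 d.+1) = [seq (d - val i)%N | i <- enum 'I_d.+1].
  rewrite (map_comp (fun i => d - i)%N) val_enum_ord.
  apply: (@eq_from_nth _ 0%N); first by rewrite size_rev size_map.
  move=> i; rewrite size_rev size_iota => hi.
  rewrite nth_rev ?size_iota // (nth_map 0%N) ?size_iota // !nth_iota ?subSS ?ltnS ?leq_subr //.
rewrite -map_comp; congr flatten; apply: eq_map => i /=.
have <- : cand_prob R i = (2 ^ (d - i))%N%:R^-1; last first.
  by rewrite -map_comp -[in RHS](size_enum_ord m); elim: (enum 'I_m) => //= j s ->.
rewrite /cand_prob.
have hi : (i <= d)%N by rewrite -ltnS.
have -> : (2 ^ d = 2 ^ (d - i) * 2 ^ i)%N by rewrite -expnD subnK.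
by rewrite natrM invfM mulrCA divff ?mulr1 // pnatr_eq0 expn_eq0.
Qed.

Lemma prob_misE d m :
  prob_mis pos alpha beta eps P Noise name F d m =
  1 - seq_mean step (level_probs m d) mis_fail (fun=> Worker).
Proof.
rewrite -schedule_probs -joint_mean_seq; last first.
  by rewrite allpairs_uniq ?enum_uniq // => -[? ?] [? ?].
rewrite -[X in _ = X - _](joint_mean1 'I_n (fun t : 'I_d.+1 * 'I_m => cand_prob R t.1)).
rewrite -sumrB; apply: eq_bigr => w _.
rewrite -[X in _ = X - _]mulr1 -mulrBr; congr (_ * _).
rewrite /leaders mis_swd_foldl /mis_fail.
by case: is_mis; rewrite /= ?subr0 ?subrr.
Qed.

Lemma mis_fail_le1 st : mis_fail st <= 1.
Proof. by rewrite lern1 leq_b1. Qed.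

(** Without workers, reliability is vacuous and no worker can reappear, so the invariant persists to
    the end. *)
Lemma no_worker_fail m B st : (forall u, ~~ is_worker (st u)) -> Inv B st ->
  seq_mean step (nseq m 1) mis_fail st <= 0.
Proof.
elim: m st => [|m IH] st nw inv /=.
  by rewrite /mis_fail (mis_of_inv inv nw).
rewrite -[leRHS](@coin_mean_cst R 'I_n 1 0).
apply: ler_coin_mean => [|c]; first by rewrite ler01 lexx.
apply: IH => [u|]; first by apply: contra (nw u); apply: next_worker_sub.
by apply: mis_inv_next inv => u wu; have := nw u; rewrite wu.
Qed.

(** Only the all-true coin vector has non-zero weight. It turns every isolated worker into a leader
    in the first sub-phase. *)
Lemma last_phase_fail m st : (0 < m)%N -> Inv 1 st ->
  seq_mean step (nseq m 1) mis_fail st <= 0.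
Proof.
case: m => // m _ inv /=; apply: sumr_le0 => c _.
have [call|/existsP[v cv]] := boolP [forall v, c v]; last first.
  by rewrite /coin_weight (bigD1 v) //= /bern (negbTE cv) subrr !mul0r.
rewrite mulr_ge0_le0 ?coin_weight_ge0 ?ler01 ?lexx //.
apply: (@no_worker_fail _ 1); last first.
  by apply: (mis_inv_next _ inv); apply: isolated_reliable.
move=> u; rewrite is_worker_next; case wu: (is_worker (st u)) => //=.
have -> // : becomes_leader pos alpha beta eps P Noise name F st c u.
by apply: isolated_workers_lead inv (forallP call) _; rewrite wu.
Qed.

Variable jam : {set 'I_n} -> 'I_n -> {ffun 'I_n -> bool} -> bool.
Variable b : R.
Hypothesis b_ge0 : 0 <= b.
Hypothesis jam_prob : forall (W : {set 'I_n}) (u : 'I_n) (D : nat),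
  (forall v, v \in W ->
    (#|[set w in W | adj pos alpha beta eps P Noise v w]| <= D)%N) -> (0 < D)%N ->
  coin_mean (D%:R^-1 : R) (fun c => (jam W u c)%:R) <= b.
Hypothesis jam_delivers : forall (W : {set 'I_n}) (u : 'I_n) (c : {ffun 'I_n -> bool}),
  ~~ jam W u c ->
  delivers pos alpha beta eps P Noise name F (fun v => (v \in W) && c v) u.

(** Every phase but the last costs at most [phi] and the last costs nothing; this is why the factor
    is [log Delta] although there are [log Delta + 1] phases. *)
Lemma levels_fail (d m e : nat) (phi : R) st : (0 < m)%N -> (e < d)%N ->
  n%:R * ((31 / 32) ^+ m + b * 4 * (2 ^ d)%N%:R) <= phi ->
  Inv (2 ^ e.+1).+1 st ->
  seq_mean step (level_probs m e.+1) mis_fail st <= e.+1%:R * phi.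
Proof.
move=> m0 + hphi.
have lam0 : 0 <= (31 / 32) ^+ m :> R by rewrite exprn_ge0 //; lra.
have bD e' : 0 <= b * 4 * (2 ^ e')%N%:R by rewrite !mulr_ge0.
have phi0 : 0 <= phi by apply: le_trans hphi; rewrite mulr_ge0 // addr_ge0.
have fb e' st' : (e' < d)%N ->
    fail_bound pos alpha beta eps P Noise b e' m st' <= phi.
  move=> ed; apply: le_trans hphi; rewrite /fail_bound big_mkcond.
  apply: (@le_trans _ _ (\sum_(u < n) ((31 / 32) ^+ m + b * 4 * (2 ^ d)%N%:R))).
    apply: ler_sum => u _; case: ifP => _; last by rewrite addr_ge0.
    apply: lerD; first by rewrite ler_piMl // lern1 leq_b1.
    by rewrite ler_wpM2l ?mulr_ge0 // ler_nat leq_exp2l.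
  by rewrite sumr_const card_ord [leRHS]mulr_natl.
elim: e st => [|e IH] st ed inv; rewrite level_probsS seq_mean_cat.
  rewrite mul1r; apply: le_trans (phase_fail b_ge0 jam_prob jam_delivers m (tau := 0) _ _ _ inv) _ => //.
  - by move=> st'; apply: seq_mean_le1 mis_fail_le1; rewrite /level_probs /= cats0 expn0 invr1; apply/allP => q /nseqP[-> _]; rewrite ler01 lexx.
  - by move=> st' inv'; rewrite /level_probs /= cats0 expn0 invr1; apply: last_phase_fail.
  - by rewrite add0r fb.
have e1phi : 0 <= e.+1%:R * phi by rewrite mulr_ge0.
apply: le_trans (phase_fail b_ge0 jam_prob jam_delivers m (tau := e.+1%:R * phi) _ _ _ inv) _ => //.
- move=> st'; apply: seq_mean_le1 mis_fail_le1.
  apply/allP => q /flatten_mapP[i _ /nseqP[-> _]].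
  by rewrite invr_ge0 ler0n invf_le1 ?ltr0n ?expn_gt0 // ler1n expn_gt0.
- by move=> st' inv'; apply: IH; [apply: ltnW | apply: mis_inv_leq inv'].
by rewrite -[e.+2%:R]natr1 mulrDl mul1r lerD2l fb.
Qed.

Lemma prob_mis_ge (d m : nat) (phi : R) : (0 < m)%N -> (0 < d)%N ->
  (forall v, (degree pos alpha beta eps P Noise v <= 2 ^ d)%N) ->
  n%:R * ((31 / 32) ^+ m + b * 4 * (2 ^ d)%N%:R) <= phi ->
  1 - d%:R * phi <= prob_mis pos alpha beta eps P Noise name F d m.
Proof.
move=> m0; case: d => // d _ hdeg hphi; rewrite prob_misE lerD2l lerN2.
apply: levels_fail hphi _ => //; split=> //.
move=> u _; rewrite ltnS; apply: leq_trans (hdeg u).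
by rewrite /degree subset_leq_card //; apply/subsetP => w; rewrite !inE adjC.
Qed.

End Procedure.

(** * Choice of constants and final estimates *)

Lemma tolerable_interference (R : realType) (alpha beta eps P Noise : R) :
  2 < alpha -> 0 < Noise -> 1 <= beta -> 0 < eps < 1 -> 0 < P ->
  let R0 := (1 - eps) * range alpha beta P Noise in
  0 < R0 /\ exists2 tau, 0 < tau &
    beta * (Noise + tau * (P * (R0 / 2) `^ (- alpha))) <= P * R0 `^ (- alpha).
Proof.
move=> al2 N0 b1 /andP[e0 e1] P0 R0.
have b0 : 0 < beta by apply: lt_le_trans b1.
have q0 : 0 < P / (Noise * beta) by rewrite divr_gt0 // mulr_gt0.
have r0 : 0 < range alpha beta P Noise by rewrite powR_gt0.
have d0 : 0 < 1 - eps by rewrite subr_gt0.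
have R00 : 0 < R0 by rewrite mulr_gt0.
split=> //.
have range_inv : range alpha beta P Noise `^ (- alpha) = Noise * beta / P.
  have al0 : alpha != 0 by rewrite gt_eqF //; lra.
  rewrite /range -powRrM mulrN mulVf //.
  by rewrite powR_inv1 ?(ltW q0) // invf_div.
(* Noise alone would allow reception up to [range]; at distance [R0] the signal is stronger by the
   factor [(1 - eps)^(-alpha) > 1]. *)
have sig : beta * Noise < P * R0 `^ (- alpha).
  rewrite /R0 (powRM _ (ltW d0) (ltW r0)) range_inv.
  rewrite [ltRHS](_ : _ = (1 - eps) `^ (- alpha) * (beta * Noise)); last first.
    by field; rewrite gt_eqF.
  rewrite ltr_pMl ?mulr_gt0 //.
  rewrite /powR gt_eqF // expR_gt1 nmulr_rgt0; last by lra.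
  by rewrite ln_lt0 // d0 gtrBl.
have den0 : 0 < beta * (P * (R0 / 2) `^ (- alpha)).
  by rewrite !mulr_gt0 // powR_gt0 // divr_gt0.
(* This [tau] uses up the slack exactly: the required inequality becomes an equality. *)
exists ((P * R0 `^ (- alpha) - beta * Noise) / (beta * (P * (R0 / 2) `^ (- alpha)))).
  by rewrite divr_gt0 // subr_gt0.
move: den0; set x := P * (R0 / 2) `^ _ => den0.
have x0 : x != 0 by apply: contraTneq den0 => ->; rewrite mulr0 ltxx.
rewrite [leLHS](_ : _ = P * R0 `^ (- alpha)) //; field.
by rewrite x0 gt_eqF.
Qed.

(** As [alpha > 2], it suffices that [B] reaches [(G/tau)^(1/(alpha-2))]; the maximum with [0]
    covers negative [G]. *)
Lemma powR_dominates_square (R : realType) (alpha G tau : R) :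
  2 < alpha -> 0 < tau ->
  exists m : nat, forall B : nat, (m <= B)%N -> (0 < B)%N ->
    G * B%:R ^+ 2 <= tau * B%:R `^ alpha.
Proof.
move=> al2 tau0; pose a := Num.max 0 (G / tau).
have a0 : 0 <= a by rewrite le_max lexx.
exists (Num.truncn (a `^ (alpha - 2)^-1)).+1 => B mB B0.
have b0 : 0 < B%:R :> R by rewrite ltr0n.
have aB : a `^ (alpha - 2)^-1 <= B%:R.
  by apply: ltW; apply: lt_le_trans (truncnS_gt _) _; rewrite ler_nat.
have GB : G / tau <= B%:R `^ (alpha - 2).
  apply: (@le_trans _ _ a); first by rewrite le_max lexx orbT.
  have al0 : alpha - 2 != 0 by rewrite gt_eqF // subr_gt0.
  rewrite -[leLHS]powRr1 // -[X in a `^ X](mulVf al0) powRrM; apply: ge0_ler_powR => //.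
  - by rewrite subr_ge0 ltW.
  - by rewrite nnegrE powR_ge0.
  - by rewrite nnegrE ler0n.
have -> : B%:R `^ alpha = B%:R `^ (alpha - 2) * B%:R ^+ 2 :> R.
  by rewrite -powR_mulrn ?ler0n // -powRD ?subrK // (gt_eqF b0) implybT.
by rewrite mulrA ler_wpM2r ?sqr_ge0 // mulrC -ler_pdivrMr.
Qed.

Lemma expRN_nat_le (R : realType) (m : nat) : expR (- m%:R) <= (2 ^+ m)^-1 :> R.
Proof.
rewrite expRN lef_pV2 ?posrE ?expR_gt0 ?exprn_gt0 // -[m%:R]mulr1 expRM_natl.
by apply: lerXn2r; rewrite ?nnegrE ?expR_ge0 //; have := expR_ge1Dx (1 : R); lra.
Qed.

(** From [31/32 <= exp (-1/32)], whose power [128 m] is [exp (-4m)]. *)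
Lemma expn_31_32_le (R : realType) (m : nat) : (31 / 32) ^+ (128 * m) <= (2 ^+ (4 * m))^-1 :> R.
Proof.
apply: le_trans (expRN_nat_le R (4 * m)).
have -> : - (4 * m)%:R = (128 * m)%:R * (- 32^-1) :> R by rewrite !natrM; field.
rewrite expRM_natl lerXn2r ?nnegrE ?expR_ge0 //; first by lra.
by have := expR_ge1Dx (- 32^-1 : R); lra.
Qed.

Theorem theorem2 (R : realType) (alpha beta eps P Noise : R) :
  2 < alpha -> 0 < Noise -> 1 <= beta -> 0 < eps < 1 -> 0 < P ->
  (* c1 sufficiently large *)
  exists c1min : nat, forall c1 : nat, (c1min <= c1)%N ->
  (* C sufficiently large *)
  exists Cmin : nat, forall C : nat, (Cmin <= C)%N ->
  (* for ssfs of length O(log^7 N), with constant L *)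
  forall L : nat, exists K : nat,
  forall (n kN d : nat) (pos : 'I_n -> R * R) (name : 'I_n -> nat)
         (F : seq (nat -> bool)),
    injective pos ->
    injective name -> (forall v, (0 < name v <= 2 ^ kN)%N) ->
    (* Delta = 2^d is the maximum degree of G, log Delta = d >= 1 *)
    (\max_(v : 'I_n) degree pos alpha beta eps P Noise v = 2 ^ d)%N ->
    (1 <= d)%N ->
    is_ssf (2 ^ kN) (c1 * kN ^ 3) F -> (size F <= L * kN ^ 7)%N ->
    (* termination after O(log^8 N log Delta) rounds *)
    (forall omega : {ffun ('I_d.+1 * 'I_(C * kN)) * 'I_n -> bool},
        ((mis_swd pos alpha beta eps P Noise name F omega).2
           <= K * kN ^ 8 * d)%N) /\
    (* Pr[leaders form a MIS of G] >= 1 - log Delta / n^2 *)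
    1 - d%:R / (n%:R ^+ 2) <=
      prob_mis pos alpha beta eps P Noise name F d (C * kN).
Proof.
move=> al2 N0 b1 e01 P0.
have [R00 [tau tau0 hsig]] := tolerable_interference al2 N0 b1 e01 P0.
have [m0 hm0] := powR_dominates_square (200 / (1 - 2 `^ (2 - alpha))) al2 tau0.
(* The summand [m0] makes the far interference tolerable, and [9] ensures [B^2 >= 9 kN] for
   [B = rho * kN]. *)
pose rho := (m0 + 9)%N.
exists (38 * rho ^ 2)%N => c1 hc1; exists 128%N => C hC L.
exists (4 * C * L)%N => n kN d pos name F posI nameI nameN hDelta d1 ssf szF.
have d_gt0 : (0 < d)%N by [].
have hdeg v : (degree pos alpha beta eps P Noise v <= 2 ^ d)%N.
  by rewrite -hDelta; apply: leq_bigmax.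
have n2d : (2 ^ d <= n)%N.
  rewrite -hDelta; apply/bigmax_leqP => v _.
  by rewrite /degree -[leqRHS]card_ord max_card.
have n2 : (2 <= n)%N by apply: leq_trans n2d; rewrite -{1}[2%N]expn1 leq_exp2l.
have nN : (n <= 2 ^ kN)%N.
  have : uniq [seq name v | v <- enum 'I_n] by rewrite map_inj_uniq ?enum_uniq.
  move/uniq_leq_size => /(_ (iota 1 (2 ^ kN))).
  rewrite size_map size_enum_ord size_iota; apply => y /mapP[v _ ->].
  by rewrite mem_iota add1n ltnS.
have kN0 : (0 < kN)%N.
  by case: kN nN {nameN ssf szF} => //; rewrite expn0 leqNgt n2.
split.
  move=> omega; rewrite mis_swd_rounds.
  (* Here [d + 1 <= 2d]; each sub-phase executes the ssf twice. *)
  apply: (@leq_trans ((2 * d) * (C * kN) * (2 * (L * kN ^ 7)))%N).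
    by rewrite !leq_mul //; lia.
  by rewrite (_ : kN ^ 8 = kN * kN ^ 7)%N ?expnS //; nia.
pose B := (rho * kN)%N.
have rhoB : (rho <= B)%N by rewrite leq_pmulr.
have B2 : (2 <= B)%N by apply: leq_trans rhoB; rewrite /rho; lia.
have B0 : (0 < B)%N by apply: ltnW.
have hx : (38 * B ^ 2 <= c1 * kN ^ 3)%N.
  rewrite /B expnMn mulnA leq_mul // leq_pexp2l //.
have ht : 200 / (1 - 2 `^ (2 - alpha)) * B%:R ^+ 2 <= tau * B%:R `^ alpha.
  by apply: hm0 => //; apply: leq_trans rhoB; rewrite leq_addr.
pose b := 2 * expR (- B%:R ^+ 2) : R.
have b_ge0 : 0 <= b by rewrite mulr_ge0 ?expR_ge0.
have beta0 : 0 < beta by apply: lt_le_trans b1.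
have m_gt0 : (0 < C * kN)%N by rewrite muln_gt0 kN0 andbT; apply: leq_trans hC.
have n0 : 0 < n%:R :> R by rewrite ltr0n; apply: leq_trans n2.
have -> : d%:R / n%:R ^+ 2 = d%:R * (n%:R ^+ 2)^-1 :> R by [].
apply: (prob_mis_ge (jam := fun W =>
  jammed pos alpha beta eps P Noise W B (c1 * kN ^ 3) (tau * B%:R `^ alpha)) b_ge0) => //.
- by move=> W u D hW D0; apply: jammed_prob.
- by move=> W u c; apply: not_jammed_delivers.
(* With [x = 1/N] and [n x <= 1], the failure cost per phase times [n^2] is at most
   [(n x)^3 (x + 8 x^5) <= 1/2 + 1/4]. *)
pose x : R := (2 ^+ kN)^-1.
have x0 : 0 < x by rewrite invr_gt0 exprn_gt0.
have x2 : x <= 2^-1.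
  by rewrite lef_pV2 ?posrE ?exprn_gt0 // -[leLHS]expr1 ler_weXn2l // ler1n.
have xn : n%:R * x <= 1.
  by rewrite ler_pdivrMr ?exprn_gt0 // mul1r -natrX ler_nat.
have lam : (31 / 32) ^+ (C * kN) <= x ^+ 4.
  apply: (@le_trans _ _ ((31 / 32) ^+ (128 * kN))).
    by apply: ler_wiXn2l; rewrite ?leq_mul2r ?hC ?orbT //; lra.
  by apply: le_trans (expn_31_32_le R kN) _; rewrite exprVn -exprM mulnC.
have bx : b <= 2 * x ^+ 9.
  rewrite ler_wpM2l // (le_trans _ (_ : (2 ^+ (9 * kN))^-1 <= _)) //; last first.
    by rewrite exprVn -exprM mulnC.
  apply: le_trans (expRN_nat_le R (9 * kN)).
  rewrite ler_expR lerN2 -natrX ler_nat.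
  have sq i : (0 < i)%N -> (i <= i ^ 2)%N by move=> i0; rewrite expnS expn1 leq_pmulr.
  rewrite /B expnMn leq_mul ?sq //.
  by apply: leq_trans (sq _ _); rewrite /rho ?leq_addl // addn_gt0 orbT.
have dn : b * 4 * (2 ^ d)%N%:R <= 8 * x ^+ 8.
  have : (2 ^ d)%N%:R * x <= 1.
    apply: le_trans xn; rewrite ler_wpM2r ?(ltW x0) // ler_nat //.
  set y := (2 ^ d)%N%:R => yx.
  have y0 : 0 <= y by rewrite ler0n.
  apply: (@le_trans _ _ (2 * x ^+ 9 * 4 * y)); first by rewrite ler_wpM2r // ler_wpM2r.
  have -> : 2 * x ^+ 9 * 4 * y = 8 * x ^+ 8 * (y * x) by ring.
  by rewrite ler_piMr // mulr_ge0 // exprn_ge0 // ltW.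
rewrite -[leRHS]mul1r ler_pdivlMr ?exprn_gt0 //.
apply: (@le_trans _ _ (n%:R * (x ^+ 4 + 8 * x ^+ 8) * n%:R ^+ 2)).
  by rewrite ler_wpM2r ?sqr_ge0 // ler_wpM2l ?ler0n // lerD.
have -> : n%:R * (x ^+ 4 + 8 * x ^+ 8) * n%:R ^+ 2 = (n%:R * x) ^+ 3 * (x + 8 * x ^+ 5).
  by ring.
have x5 : x ^+ 5 <= 2^-1 ^+ 5 by rewrite lerXn2r // nnegrE ?(ltW x0) // invr_ge0.
apply: (@le_trans _ _ (1 * (2^-1 + 8 * 2^-1 ^+ 5))); last by rewrite !exprS expr0; lra.
rewrite ler_pM //.
- by rewrite exprn_ge0 // mulr_ge0 ?ler0n // ltW.
- by rewrite addr_ge0 ?mulr_ge0 ?exprn_ge0 ?(ltW x0).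
- by rewrite exprn_ile1 // mulr_ge0 ?ler0n // ltW.
- by rewrite lerD // ler_wpM2l.
Qed.
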